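(* Let $n$ be a positive integer. The monoid of reachable positions of even size on an $n$-column board, under addition, is generated by the $n^2$ elements corresponding to all possible red-yellow move pairs (a red token placed in some column, followed by a yellow token placed in some column). Specifically, this generating set is the union of the orbits of $(R, Y, \varepsilon, \dots, \varepsilon)$ and $(RY, \varepsilon, \dots, \varepsilon)$ under the action of the symmetric group $S_n$ permuting the columns (for $n=1$ the first orbit is absent).
   Context: A column is an infinite vertical stack of cells (with a bottom cell, and unbounded upward), and a board is a finite sequence of columns (so the columns are distinguishable). A position on a board is a placement of finitely many tokens in cells such that each token is either red or yellow, no two tokens occupy the same cell, and the occupied cells in each column form a contiguous block starting from the bottom. A position on an $n$-column board is identified with an $n$-tuple of finite words over $\{R,Y\}$ ($R$ for red, $Y$ for yellow), the word of each column being read from bottom to top; $\varepsilon$ denotes the empty word. The size of a position is its number of tokens. A reachable position is one that can be obtained from the empty board by a finite sequence of moves, where each move inserts a token into the lowest empty cell of some column, and the inserted tokens alternate globally between red and yellow from move to move, the first move placing a red token. There is no win condition. Addition of positions on the same board is column-wise concatenation: in each column, the word of $P_1+P_2$ is the word of $P_1$ followed by the word of $P_2$. Under this operation the set of all positions on an $n$-column board is the $n$th direct power of the free monoid on $R$ and $Y$, and the reachable positions of even size form a submonoid of it. *)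

(* Defs.v *)
From HB Require Import structures.
From mathcomp Require Import all_boot all_fingroup.
From mathcomp Require Import mathcomp_extra boolp classical_sets functions cardinality.

Set Implicit Arguments.
Unset Strict Implicit.
Unset Printing Implicit Defensive.

Local Open Scope classical_set_scope.

Inductive token := Red | Yellow.

Definition other (t : token) : token := if t is Red then Yellow else Red.

Definition is_red (t : token) : bool := if t is Red then true else false.
Definition token_of_bool (b : bool) : token := if b then Red else Yellow.
Lemma is_redK : cancel is_red token_of_bool. Proof. by case. Qed.
HB.instance Definition _ := Countable.copy token (can_type is_redK).

(* The free monoid on the two colors; a word is read from bottom to top. *)
Definition word : Type := seq token.
HB.instance Definition _ := Choice.copy word (seq token).

Definition word_mul (u v : word) : word := u ++ v.
Definition word_one : word := [::].
Lemma word_mulA : associative word_mul. Proof. exact: catA. Qed.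
Lemma word_mul1w : left_id word_one word_mul. Proof. by []. Qed.
Lemma word_mulw1 : right_id word_one word_mul. Proof. exact: cats0. Qed.
HB.instance Definition _ :=
  isMonoid.Build word word_mulA word_mul1w word_mulw1.

(* Positions on an n-column board. The pointwise monoid structure that {ffun _}
   inherits from word is column-wise concatenation: the addition P + Q of
   positions is written P * Q, and the empty board is 1 (both in group_scope). *)
Notation position n := {ffun 'I_n -> word}.

Section Board.
Variable n : nat.
Implicit Types (P : position n) (t : token).

Definition pos_size P : nat := \sum_(i < n) size (P i).

Definition insert t (i : 'I_n) P : position n :=
  [ffun j => if j == i then rcons (P j) t else P j].

(* Successive moves in the columns listed in cs, the first token having color t
   and the colors alternating. *)
Fixpoint play t (cs : seq 'I_n) P : position n :=
  if cs is i :: cs' then play (other t) cs' (insert t i P) else P.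

Definition reachable P : Prop := exists cs : seq 'I_n, play Red cs 1%g = P.

Definition even_reachable : set (position n) :=
  [set P | reachable P /\ ~~ odd (pos_size P)].

Definition move_pair (i j : 'I_n) : position n :=
  insert Yellow j (insert Red i 1%g).

Definition move_pairs : set (position n) :=
  [set P | exists i j : 'I_n, P = move_pair i j].

(* The word of column i moves to column s i; the inverse makes this a right
   action for the left-to-right product of permutations. *)
Definition permute_columns P (s : 'S_n) : position n :=
  [ffun i => P (s^-1%g i)].

Lemma permute_columns_is_action : is_action [set: 'S_n]%SET permute_columns.
Proof.
apply: is_total_action => [P|P s t].
  by apply/ffunP => i; rewrite ffunE invg1 perm1.
by apply/ffunP => i; rewrite !ffunE invMg permM.
Qed.
Canonical permute_columns_action := Action permute_columns_is_action.

(* The library's action.orbit requires a finite carrier type. *)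
Definition column_orbit P : set (position n) :=
  [set permute_columns P s | s in [set: 'S_n]].

(* The position (w_0, ..., w_{k-1}, epsilon, ..., epsilon). When k > n the
   extra words are dropped. *)
Definition columns (ws : seq word) : position n :=
  [ffun i : 'I_n => nth [::] ws i].

Definition split_pair : position n := columns [:: [:: Red]; [:: Yellow]].
Definition stacked_pair : position n := columns [:: [:: Red; Yellow]].

(* For n <= 1 the position (R, Y, epsilon, ..., epsilon) does not exist, and
   its orbit is absent. *)
Definition split_pair_orbit : set (position n) :=
  [set P | 1 < n /\ column_orbit split_pair P].

End Board.

Arguments even_reachable : clear implicits.
Arguments move_pairs : clear implicits.
Arguments columns : clear implicits.
Arguments split_pair : clear implicits.
Arguments stacked_pair : clear implicits.
Arguments split_pair_orbit : clear implicits.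

Definition is_submonoid (G : monoidType) (M : set G) : Prop :=
  monoid_closed (mem M).

Definition generated_submonoid (G : monoidType) (S : set G) : set G :=
  smallest (@is_submonoid G) S.

(* Main.v *)
(** Appending a token adds it on the right of a position, so playing a list of
    moves on P multiplies P by the position which that list builds on the empty
    board. An even number of moves brings the color back to red; hence a
    sequence of even length splits into consecutive red-yellow pairs, and two
    such sequences can be played one after the other. The columns of the two
    tokens can be read off a move pair, whence the count n^2. Permuting the
    columns moves the pair (i, j) to (s i, s j), and the symmetric group has two
    orbits on ordered pairs: i = j and i <> j. *)

Require Import Defs.
From HB Require Import structures.
From mathcomp Require Import all_boot all_fingroup.
From mathcomp Require Import mathcomp_extra boolp classical_sets functions cardinality.

Local Open Scope classical_set_scope.

Section Play.
Variable n : nat.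
Implicit Types (P Q : position n) (t : token) (i j : 'I_n) (cs : seq 'I_n).

Lemma positionM P Q i : (P * Q)%g i = P i ++ Q i.
Proof. by rewrite ffunE. Qed.

Lemma position1 i : (1%g : position n) i = [::].
Proof. by rewrite ffunE. Qed.

Lemma insertM t i P Q : insert t i (P * Q)%g = (P * insert t i Q)%g.
Proof.
apply/ffunP => k; rewrite positionM !ffunE.
by case: ifP => _ //; rewrite rcons_cat.
Qed.

Lemma playM t cs P Q : play t cs (P * Q)%g = (P * play t cs Q)%g.
Proof. by elim: cs t Q => //= i cs IH t Q; rewrite insertM IH. Qed.

Lemma play1 t cs P : play t cs P = (P * play t cs 1)%g.
Proof. by rewrite -playM mulg1. Qed.

Lemma play_cat t cs1 cs2 P : ~~ odd (size cs1) ->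
  play t (cs1 ++ cs2) P = play t cs2 (play t cs1 P).
Proof.
(* Induction on a bound for the length, since each step removes two moves. *)
have [m le_m] := ubnP (size cs1).
elim: m => // m IH in cs1 P le_m *; case: cs1 le_m => [|i [|j cs]] //= le_m.
have -> : other (other t) = t by case: (t).
by rewrite negbK => even_cs; rewrite IH // ltnW.
Qed.

Lemma pos_size_insert t i P : pos_size (insert t i P) = (pos_size P).+1.
Proof.
rewrite /pos_size (bigD1 i) //= [in RHS](bigD1 i) //= ffunE eqxx size_rcons.
rewrite addSn; congr (_ + _).+1; apply: eq_bigr => k /negPf k_neq_i.
by rewrite ffunE k_neq_i.
Qed.

Lemma pos_size_play t cs P :
  pos_size (play t cs P) = size cs + pos_size P.
Proof.
by elim: cs t P => //= i cs IH t P; rewrite IH pos_size_insert addnS.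
Qed.

Lemma pos_size1 : pos_size (1%g : position n) = 0.
Proof. by rewrite /pos_size big1 // => i _; rewrite position1. Qed.

(** Each move adds exactly one token, so the parity of the size is that of the number of moves. *)
Lemma even_reachableP P :
  even_reachable n P <-> exists2 cs, ~~ odd (size cs) & play Red cs 1%g = P.
Proof.
split=> [[[cs <-]]|[cs even_cs <-]].
  by rewrite pos_size_play pos_size1 addn0; exists cs.
by split; [exists cs | rewrite pos_size_play pos_size1 addn0].
Qed.

Lemma even_reachable_submonoid : is_submonoid (even_reachable n).
Proof.
split; first by apply/mem_set/even_reachableP; exists [::].
move=> P Q /set_mem/even_reachableP[cs even_cs <-].
move=> /set_mem/even_reachableP[ds even_ds <-].
apply/mem_set/even_reachableP; exists (cs ++ ds).
  by rewrite size_cat oddD (negPf even_cs) (negPf even_ds).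
by rewrite play_cat // play1.
Qed.

Lemma move_pairs_even_reachable : move_pairs n `<=` even_reachable n.
Proof. by move=> _ [i [j ->]]; apply/even_reachableP; exists [:: i; j]. Qed.

(** This gives minimality: [M] ranges over the submonoids whose intersection is the generated
    one. *)
Lemma even_play_mem (M : set (position n)) cs :
  is_submonoid M -> move_pairs n `<=` M -> ~~ odd (size cs) ->
  M (play Red cs 1%g).
Proof.
move=> [M1 MM] pairsM; have [m le_m] := ubnP (size cs).
elim: m => // m IH in cs le_m *; case: cs le_m => [|i [|j cs]] //= le_m.
  by move=> _; exact: set_mem.
(* [play1] splits off the first two moves as the left factor [move_pair i j]. *)
rewrite negbK play1 => even_cs; apply/set_mem/MM; apply/mem_set.
  by apply: pairsM; exists i, j.
by apply: IH => //; exact: ltnW.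
Qed.

Lemma generated_move_pairs :
  generated_submonoid (move_pairs n) = even_reachable n.
Proof.
apply/seteqP; split.
  exact: smallest_sub even_reachable_submonoid move_pairs_even_reachable.
move=> _ /even_reachableP[cs even_cs <-] M [subM pairsM].
exact: even_play_mem.
Qed.

End Play.

Section MovePairs.
Variable n : nat.
Implicit Types i j k : 'I_n.

Lemma move_pairE i j k :
  move_pair i j k = nseq (k == i) Red ++ nseq (k == j) Yellow.
Proof. by rewrite !ffunE; case: (k == i); case: (k == j). Qed.

Lemma red_move_pair i j k : (Red \in move_pair i j k) = (k == i).
Proof. by rewrite move_pairE; case: (k == i); case: (k == j). Qed.

Lemma yellow_move_pair i j k : (Yellow \in move_pair i j k) = (k == j).
Proof. by rewrite move_pairE; case: (k == i); case: (k == j). Qed.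

Lemma move_pair_inj : injective (fun p : 'I_n * 'I_n => move_pair p.1 p.2).
Proof.
move=> [i j] [i' j'] /= eq_pair; congr pair; apply/eqP.
  by rewrite -(red_move_pair i' j') -eq_pair red_move_pair.
by rewrite -(yellow_move_pair i' j') -eq_pair yellow_move_pair.
Qed.

Lemma card_move_pairs : (move_pairs n #= `I_(n ^ 2))%card.
Proof.
have -> : move_pairs n =
    [set move_pair p.1 p.2 | p in [set: 'I_n * 'I_n]].
  apply/seteqP; split=> [_ [i [j ->]]|_ [[i j] _ <-]]; first by exists (i, j).
  by exists i, j.
apply: (card_eq_trans (inj_card_eq (in2W move_pair_inj))).
have -> : n ^ 2 = #|{: 'I_n * 'I_n}| by rewrite card_prod card_ord.
rewrite card_eq_sym; apply: (card_eq_trans card_II).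
(* Enumerating the pairs by ordinals turns the finite cardinal into a bijection of sets. *)
have -> : [set: 'I_n * 'I_n] = [set enum_val i | i in [set: 'I_#|{: 'I_n * 'I_n}|]].
  by apply/seteqP; split=> // p _; exists (enum_rank p); rewrite ?enum_rankK.
by rewrite card_eq_sym; apply: inj_card_eq => i j _ _; exact: enum_val_inj.
Qed.

Lemma permute_move_pair i j (s : 'S_n) :
  permute_columns (move_pair i j) s = move_pair (s i) (s j).
Proof.
apply/ffunP => k; rewrite ffunE !move_pairE.
(* Applying [s] to both sides turns [s^-1 k == i] into [k == s i]. *)
by rewrite -!(inj_eq (@perm_inj _ s) (s^-1%g k)) permKV.
Qed.

End MovePairs.

(** Double transitivity of the symmetric group, which puts all pairs of distinct columns in one
    orbit. *)
Lemma perm_two_points (T : finType) (a b i j : T) : a != b -> i != j ->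
  exists s : {perm T}, s a = i /\ s b = j.
Proof.
move=> a_neq_b i_neq_j; set b' := tperm a i b.
have b'_neq_i : b' != i by rewrite -(tpermL a i) (inj_eq perm_inj) eq_sym.
(* The first factor sends [a] to [i] and [b] to [b']; the second sends [b'] to [j] and fixes [i],
   which differs from both. *)
exists (tperm a i * tperm b' j)%g; rewrite !permM tpermL -/b' tpermL.
by rewrite tpermD // eq_sym.
Qed.

Lemma stacked_pairE n (a : 'I_n) : a = 0 :> nat ->
  stacked_pair n = move_pair a a.
Proof.
move=> a0; apply/ffunP => k; rewrite ffunE move_pairE -!val_eqE /= a0.
(* Past the listed words [nth] returns its default, the empty word. *)
by case: (nat_of_ord k) => [|[]].
Qed.

Lemma split_pairE n (a b : 'I_n) : a = 0 :> nat -> b = 1 :> nat ->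
  split_pair n = move_pair a b.
Proof.
move=> a0 b1; apply/ffunP => k; rewrite ffunE move_pairE -!val_eqE /= a0 b1.
by case: (nat_of_ord k) => [|[|[]]].
Qed.

Lemma move_pairs_orbits n : 0 < n ->
  move_pairs n = split_pair_orbit n `|` column_orbit (stacked_pair n).
Proof.
move=> n_gt0; pose a := Ordinal n_gt0.
apply/seteqP; split=> [_ [i [j ->]]|P [[n_gt1]|]]; last first.
- case=> s _ <-; rewrite (stacked_pairE _ a) // permute_move_pair.
  by exists (s a), (s a).
- case=> s _ <-; rewrite (split_pairE _ a (Ordinal n_gt1)) //.
  by rewrite permute_move_pair; exists (s a), (s (Ordinal n_gt1)).
have [<-|i_neq_j] := eqVneq i j.
  right; exists (tperm a i) => //.
  by rewrite (stacked_pairE _ a) // permute_move_pair tpermL.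
(* Two distinct columns exist, so the orbit of the split pair is present. *)
have n_gt1 : 1 < n.
  by rewrite -(card_ord n); apply/card_gt1P; exists i, j.
left; split=> //; pose b := Ordinal n_gt1.
have [//|s [sa sb]] := @perm_two_points _ a b i j _ i_neq_j.
by exists s => //; rewrite (split_pairE _ a b) // permute_move_pair sa sb.
Qed.

Theorem mainTheorem6 (n : nat) (n_gt0 : 0 < n) :
  [/\ generated_submonoid (move_pairs n) = even_reachable n,
      (move_pairs n #= `I_(n ^ 2))%card
    & move_pairs n = split_pair_orbit n `|` column_orbit (stacked_pair n)].
Proof.
split; [exact: generated_move_pairs | exact: card_move_pairs |].
exact: move_pairs_orbits.
Qed.
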